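(* Let $n,m,k$ be positive integers, let $G$ be a real $n\times m$ matrix and let $R$ be a real $n\times k$ matrix, such that $G^TG$ and $R^TR$ are invertible. Consider the generalized saddle-point matrix $$\begin{bmatrix} L & B^T \\ B & -C \end{bmatrix} = \begin{bmatrix} G^TG & G^TR \\ R^TG & -R^TR \end{bmatrix},$$ that is, $L = G^TG$, $B = R^TG$ and $C = R^TR$, and let $S_p = L + B^TC^{-1}B$ be its primal Schur complement. Then the leading block $L$ is spectrally equivalent to $S_p$, in the sense that $$\operatorname{spec}(L^{-1}S_p)\subseteq [1,2].$$
   Context: For a square matrix $M$, $\operatorname{spec}(M)$ denotes the set of its eigenvalues (a priori complex); the conclusion asserts that every eigenvalue of the $m\times m$ matrix $L^{-1}S_p$ is real and lies in the interval $[1,2]$. No relation between the sizes $n,m,k$ is assumed beyond what the invertibility hypotheses imply. *)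

(* Defs.v *)
From HB Require Import structures.
From mathcomp Require Import all_boot all_order all_algebra.
From mathcomp Require Import reals complex.

Set Implicit Arguments.
Unset Strict Implicit.
Unset Printing Implicit Defensive.

Import Order.TTheory GRing.Theory Num.Theory.
Local Open Scope ring_scope.
Local Open Scope complex_scope.

(* [eigenvalue] only finds eigenvalues in the coefficient field, so the real
   matrix is first embedded into the complex matrices. *)
Definition spec (K : realType) (m : nat) (M : 'M[K]_m) : {pred K[i]} :=
  [pred z | eigenvalue (map_mx (real_complex K) M) z].

Definition saddle_mx (K : realType) (m k : nat)
    (L : 'M[K]_m) (B : 'M[K]_(k, m)) (C : 'M[K]_k) : 'M[K]_(m + k) :=
  block_mx L B^T B (- C).

Definition primal_schur (K : realType) (m k : nat)
    (L : 'M[K]_m) (B : 'M[K]_(k, m)) (C : 'M[K]_k) : 'M[K]_m :=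
  L + B^T *m invmx C *m B.

(* Main.v *)
Require Import Defs.
From HB Require Import structures.
From mathcomp Require Import all_boot all_order all_algebra.
From mathcomp Require Import reals complex.

(**
With P = R (R^T R)^-1 R^T, the orthogonal projection onto the range of R, one
has S_p = G^T G + G^T P G.  A left eigenvector v of L^-1 S_p for z gives
w = v L^-1 with w S_p = z w L; pairing with w and setting q = w G^T yields
z |q|^2 = |q|^2 + |q P|^2, and 0 <= |q P|^2 <= |q|^2 with q <> 0.
*)

Set Implicit Arguments.
Unset Strict Implicit.
Unset Printing Implicit Defensive.

Import Order.TTheory GRing.Theory Num.Theory.
Local Open Scope ring_scope.
Local Open Scope complex_scope.

(** Since [P] is Hermitian and idempotent, it factors as [P] times its own adjoint. *)
Lemma proj_dotmxE (F : numClosedFieldType) n (P : 'M[F]_n) (q : 'rV[F]_n) :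
  (P ^t* )%sesqui = P -> P *m P = P ->
  (q *m P *m (q ^t* )%sesqui) 0 0 = dotmx (q *m P) (q *m P).
Proof.
move=> Pherm Pidem.
by rewrite dotmxE trmx_mul map_mxM Pherm mulmxA -(mulmxA q P P) Pidem.
Qed.

(** Pythagoras: [1 - P] is again an orthogonal projection, and the difference of the two sides is
    the squared norm of [q (1 - P)]. *)
Lemma proj_dotmx_le (F : numClosedFieldType) n (P : 'M[F]_n) (q : 'rV[F]_n) :
  (P ^t* )%sesqui = P -> P *m P = P ->
  dotmx (q *m P) (q *m P) <= dotmx q q.
Proof.
move=> Pherm Pidem; rewrite -subr_ge0.
have Qherm : ((1%:M - P) ^t* )%sesqui = 1%:M - P.
  by rewrite linearB map_mxB Pherm /= trmx1 map_mx1.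
have Qidem : (1%:M - P) *m (1%:M - P) = 1%:M - P.
  by rewrite mulmxBl mul1mx mulmxBr mulmx1 Pidem subrr subr0.
suff -> : dotmx q q - dotmx (q *m P) (q *m P)
        = dotmx (q *m (1%:M - P)) (q *m (1%:M - P)) by exact: dnorm_ge0.
(* As quadratic forms, both projected norms are linear in the projection. *)
rewrite -(proj_dotmxE q Qherm Qidem) -(proj_dotmxE q Pherm Pidem) dotmxE.
rewrite mulmxBr mulmx1 mulmxBl.
by move: (q *m P *m _) (q *m _) => X Y; rewrite !mxE.
Qed.

(** The inverse of the leading block is cleared into a pencil, so only the nonvanishing of [q] is
    required. *)
Lemma proj_pencil_eigenvalue (F : numClosedFieldType) n m
    (A : 'M[F]_(n, m)) (P : 'M[F]_n) (w : 'rV[F]_m) (z : F) :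
  (P ^t* )%sesqui = P -> P *m P = P -> w *m (A ^t* )%sesqui != 0 ->
  w *m ((A ^t* )%sesqui *m A + (A ^t* )%sesqui *m P *m A)
    = z *: (w *m ((A ^t* )%sesqui *m A)) ->
  1 <= z <= 2.
Proof.
move=> Pherm Pidem; set q := w *m _ => q_neq0 /(congr1 (mulmx^~ (w ^t* )%sesqui)).
have qE : (q ^t* )%sesqui = A *m (w ^t* )%sesqui.
  by rewrite trmx_mul map_mxM trmxCK.
rewrite mulmxDr !mulmxA -/q mulmxDl -scalemxAl -!(mulmxA _ A) -qE.
move=> /matrixP/(_ 0 0) zE.
have {}zE : dotmx q q + dotmx (q *m P) (q *m P) = z * dotmx q q.
  rewrite -(proj_dotmxE q Pherm Pidem) dotmxE; move: zE.
  by move: (q *m P *m _) (q *m _) => X Y; rewrite !mxE.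
have q_gt0 : 0 < dotmx q q by rewrite dnorm_gt0.
(* Both bounds are multiplied by the squared norm of [q], so that [zE] eliminates [z]. *)
rewrite -(ler_pM2r q_gt0) -(ler_pM2r q_gt0 z) -zE mul1r lerDl dnorm_ge0.
by rewrite mulr_natl mulr2n lerD2l proj_dotmx_le.
Qed.

Lemma trmxC_real (K : realType) m n (A : 'M[K]_(m, n)) :
  ((map_mx (real_complex K) A) ^t* )%sesqui = map_mx (real_complex K) A^T.
Proof. by apply/matrixP => i j; rewrite !mxE; exact: conjc_real. Qed.

Theorem theorem5p1 (K : realType) (n m k : nat)
    (n_gt0 : (0 < n)%N) (m_gt0 : (0 < m)%N) (k_gt0 : (0 < k)%N)
    (G : 'M[K]_(n, m)) (R : 'M[K]_(n, k))
    (G_inv : G^T *m G \in unitmx) (R_inv : R^T *m R \in unitmx)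
    (L : 'M[K]_m) (B : 'M[K]_(k, m)) (C : 'M[K]_k)
    (saddleE : saddle_mx L B C =
               block_mx (G^T *m G) (G^T *m R) (R^T *m G) (- (R^T *m R))) :
  forall z : K[i], z \in spec (invmx L *m primal_schur L B C) ->
    exists2 x : K, z = x%:C & 1 <= x <= 2.
Proof.
move=> z; rewrite inE => /eigenvalueP[v vz v_neq0].
have [LE _ BE /oppr_inj CE] := eq_block_mx saddleE.
pose P := R *m invmx (R^T *m R) *m R^T.
have PT : P^T = P by rewrite !trmx_mul trmx_inv !trmx_mul !trmxK mulmxA.
have PP : P *m P = P.
  by rewrite /P !mulmxA -(mulmxA _ R^T R) mulmxKV.
have SE : primal_schur L B C = G^T *m G + G^T *m P *m G.
  by rewrite /primal_schur LE BE CE trmx_mul trmxK /P !mulmxA.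
set f := real_complex K in vz *.
have LinvE : map_mx f (invmx L) *m map_mx f (G^T *m G) = 1%:M.
  by rewrite -map_mxM LE mulVmx ?map_mx1.
(* [eigenvalue] is about row vectors, hence the inverse is absorbed on the right of [v]. *)
pose w := v *m map_mx f (invmx L).
have wL : w *m map_mx f (G^T *m G) = v by rewrite -mulmxA LinvE mulmx1.
have /andP[z_ge1 z_le2] : 1 <= z <= 2.
  apply: (@proj_pencil_eigenvalue _ _ _ (map_mx f G) (map_mx f P) w).
  - by rewrite trmxC_real PT.
  - by rewrite -map_mxM PP.
  (* If [w G^T] vanished, so would [v = w G^T G]. *)
  - rewrite trmxC_real; apply: contraNneq v_neq0 => wG0.
    by rewrite -wL map_mxM mulmxA wG0 mul0mx.
  - by rewrite trmxC_real -!map_mxM -map_mxD -SE wL -vz map_mxM mulmxA.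
(* In the partial order of [K[i]], comparable numbers share their imaginary part, so [1 <= z]
   already makes [z] real. *)
have /complex_realP[x zx] : z \is Num.real by rewrite ger1_real.
by exists x; rewrite // -!lecR -zx rmorph1 rmorph_nat z_ge1.
Qed.
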